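(* Let $\mu$ be the Hawkins random sieve probability measure on the space $X$ of strictly increasing (finite or infinite) sequences of integers greater than $1$. Let $l\ge2$ and let $0<k_1<k_2<\cdots<k_{l-1}$ be integers. For $\alpha\in X$ and real $x$ denote by $\Pi_{X,X+k_1,\ldots,X+k_{l-1}}(x;\alpha)$ the number of integers $m\le x$ such that $\{m,m+k_1,\ldots,m+k_{l-1}\}\subset\alpha$. Then for $\mu$-almost every $\alpha\in X$, $$\Pi_{X,X+k_1,\ldots,X+k_{l-1}}(x;\alpha)\sim\frac{x}{(\log x)^l}\qquad (x\to\infty).$$
   Context: Hawkins random sieve (Wunderlich's formulation). Let $X$ be the set of all finite (including empty) and infinite strictly increasing sequences of integers greater than $1$, identified with subsets of $\{2,3,4,\ldots\}$. For $\alpha\in X$ and an integer $n\ge 2$ put $\alpha_n=\alpha\cap\{2,3,\ldots,n-1\}$. For integers $2\le a_1<\cdots<a_r<n$ (with $r\ge 0$ and $n\geq 2$), the elementary set $\{a_1,\ldots,a_r;n\}$ is $\{\alpha\in X:\alpha_n=\{a_1,\ldots,a_r\}\}$; for $r=0$ it is written $\{.;n\}$ and consists of all sequences all of whose elements are $\ge n$. The function $\mu$ is defined recursively on elementary sets by (i) $\mu(\{.;2\})=1$; (ii) $\mu(\{a_1,\ldots,a_r,n;n+1\})=\prod_{i=1}^{r}\left(1-\frac1{a_i}\right)\mu(\{a_1,\ldots,a_r;n\})$; (iii) $\mu(\{a_1,\ldots,a_r;n+1\})=\left(1-\prod_{i=1}^{r}\left(1-\frac1{a_i}\right)\right)\mu(\{a_1,\ldots,a_r;n\})$,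 where an empty product equals $1$. It extends uniquely to a probability measure, also denoted $\mu$, on the $\sigma$-algebra generated by the elementary sets; ''almost every/almost surely'' refers to $\mu$. (Informally: given $\alpha_n$, the integer $n$ belongs to $\alpha$ with probability $\prod_{a\in\alpha_n}(1-1/a)$.) Here $f(x)\sim g(x)$ means $f(x)/g(x)\to1$. *)

(* Defs.v *)
From HB Require Import structures.
From mathcomp Require Import all_boot all_order all_algebra finmap.
From mathcomp Require Import all_classical all_reals all_analysis.

Set Implicit Arguments.
Unset Strict Implicit.
Unset Printing Implicit Defensive.

Import Order.TTheory GRing.Theory Num.Theory.
Import numFieldNormedType.Exports.

Local Open Scope classical_set_scope.
Local Open Scope ring_scope.

(* A strictly increasing, finite or infinite, sequence of integers > 1 is
   represented by the set of its terms. *)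
Record sieve_seq := SieveSeq {
  terms :> set nat ;
  terms_gt1 : terms `<=` [set n | (1 < n)%N] }.

HB.instance Definition _ := gen_eqMixin sieve_seq.
HB.instance Definition _ := gen_choiceMixin sieve_seq.
HB.instance Definition _ := isPointed.Build sieve_seq (SieveSeq (@sub0set _ _)).

Definition initial_part (alpha : sieve_seq) (n : nat) : set nat :=
  alpha `&` [set k | (2 <= k < n)%N].

(* [elementary s n] is {a_1, ..., a_r; n} for s = [:: a_1; ...; a_r]; it is one
   of the elementary sets of the sieve only when [admissible s n]. *)
Definition elementary (s : seq nat) (n : nat) : set sieve_seq :=
  [set alpha | initial_part alpha n = [set` s]].

Definition admissible (s : seq nat) (n : nat) : bool :=
  [&& (2 <= n)%N, sorted ltn s & all (fun a => 2 <= a < n)%N s].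

Definition elementary_sets : set (set sieve_seq) :=
  [set E | exists s n, admissible s n /\ E = elementary s n].

Notation sieve_space := (g_sigma_algebraType elementary_sets).

Definition survival (R : realType) (s : seq nat) : R :=
  \prod_(a <- s) (1 - a%:R^-1).

(* By induction on n these equations determine mu on every elementary set, hence
   on the generated sigma-algebra: exactly one probability satisfies them. *)
Definition hawkins_measure (R : realType) (mu : probability sieve_space R) : Prop :=
  [/\ mu (elementary [::] 2) = 1%E,
      forall s n, admissible s n ->
        mu (elementary (rcons s n) n.+1)
        = ((survival R s)%:E * mu (elementary s n))%E
    & forall s n, admissible s n ->
        mu (elementary s n.+1)
        = ((1 - survival R s)%:E * mu (elementary s n))%E ].

(* The set of m counted here is finite, so [fset_set] loses nothing. *)
Definition constellation_count (R : realType) (ks : seq nat)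
    (alpha : sieve_seq) (x : R) : nat :=
  #|` fset_set [set m : nat | m%:R <= x /\
        [set (m + k)%N | k in [set` 0%N :: ks]] `<=` alpha] |.

(* Main.v *)
Require Import Defs.
From HB Require Import structures.
From mathcomp Require Import all_boot all_order all_algebra finmap.
From mathcomp Require Import all_classical all_reals all_analysis measurable_realfun.
From mathcomp Require Import zify ring lra.

Set Implicit Arguments.
Unset Strict Implicit.
Unset Printing Implicit Defensive.

Import Order.TTheory GRing.Theory Num.Theory.
Import numFieldNormedType.Exports.
Local Open Scope classical_set_scope.
Local Open Scope ring_scope.

(* Let [Y_n] be the conditional probability that [n] belongs to [alpha], given
   [alpha_n].  On one step [1/Y_n] increases by [1/(n-1)] on average, so
   [1/Y_n - 1 - H_(n-2)] is a martingale; its second moment stays bounded, and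
   dividing it by [k^2] and summing along [n = 2^k], and using the monotonicity of
   [Y], gives [Y_n ln n -> 1] almost surely.
   For a bounded predictable weight [p], the martingale
   [sum_(n < N) p_n (1_(n in alpha) - Y_n)] has second moment at most [N], so that
   it is [O(N^(3/4))] almost surely (along [N = k^4], then by interpolation).
   Replacing the indicators of [m + k_i in alpha] by [Y_m] one after the other,
   starting from the largest offset, each replacement costs such a martingale plus
   a telescoping sum of the decreasing sequence [Y]; hence the number of
   constellations is [sum_m Y_m^l + o(N / (ln N)^l)], and the main term is
   equivalent to [N / (ln N)^l]. *)

(** * The sieve measure on finite prefixes *)

(** List form of [initial_part alpha n]: elementary sets become its fibres, and functions of the
    past become functions on lists. *)
Definition pre (n : nat) (alpha : sieve_seq) : seq nat :=
  [seq a <- index_iota 2 n | `[< terms alpha a >]].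

Lemma mem_pre n (alpha : sieve_seq) a :
  (a \in pre n alpha) = (2 <= a < n)%N && `[< terms alpha a >].
Proof. by rewrite mem_filter mem_index_iota andbC. Qed.

Lemma preS n (alpha : sieve_seq) : (2 <= n)%N ->
  pre n.+1 alpha =
  if `[< terms alpha n >] then rcons (pre n alpha) n else pre n alpha.
Proof.
move=> n2; rewrite /pre /index_iota subSn // -[(n - 2).+1]addn1 iotaD filter_cat /=.
by rewrite subnKC //; case: ifP => _; rewrite ?cats0 ?cats1.
Qed.

Lemma admissibleS s n : admissible s n -> admissible s n.+1.
Proof.
case/and3P=> n2 ss /allP sn; apply/and3P; split => //; first exact: leqW.
by apply/allP => a /sn /andP[-> /ltnW].
Qed.

Lemma admissible_rcons s n : admissible s n -> admissible (rcons s n) n.+1.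
Proof.
case/and3P=> n2 ss sn; apply/and3P; split => //; first exact: leqW.
  case: s ss sn => //= x s ss xsn; rewrite rcons_path ss /=.
  by have /andP[] := @allP _ _ (x :: s) xsn _ (mem_last x s).
rewrite all_rcons n2 leqnn /=.
by apply/allP => a /(allP sn) /andP[-> /ltnW].
Qed.

Lemma admissible_pre n (alpha : sieve_seq) :
  (2 <= n)%N -> admissible (pre n alpha) n.
Proof.
move=> n2; apply/and3P; split => //.
- exact/(sorted_filter ltn_trans)/iota_ltn_sorted.
- by apply/allP => a; rewrite mem_pre => /andP[].
Qed.

Lemma elementaryE s n : admissible s n ->
  elementary s n = [set alpha | pre n alpha = s].
Proof.
case/and3P=> n2 ss /allP sn; apply/seteqP; split => alpha /=.
  move=> e; apply: (irr_sorted_eq ltn_trans ltnn) => //.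
    by case/and3P: (admissible_pre alpha n2).
  move=> a; rewrite mem_pre; apply/idP/idP => [/andP[an /asboolP aa]|as_].
    by suff: initial_part alpha n a; [rewrite e | split].
  by have : [set` s] a by []; rewrite -e => -[aa ->]; apply/asboolP.
move=> <-; apply/seteqP; split => a.
  by move=> [aa an]; rewrite /= mem_pre; apply/andP; split => //; apply/asboolP.
by rewrite /= mem_pre => /andP[an /asboolP aa]; split.
Qed.

(** All possible values of [pre i.+2]; the shift makes the recursion start at 2, where the only
    prefix is empty. *)
Fixpoint prefixes (i : nat) : seq (seq nat) :=
  if i is j.+1 then prefixes j ++ [seq rcons s j.+2 | s <- prefixes j]
  else [:: [::]].

Lemma admissible_prefixes i s : s \in prefixes i -> admissible s i.+2.
Proof.
elim: i s => [s|i ih s]; first by rewrite inE => /eqP->.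
rewrite mem_cat => /orP[/ih/admissibleS//|/mapP[t /ih ti ->]].
exact: admissible_rcons.
Qed.

Lemma pre_prefixes i alpha : pre i.+2 alpha \in prefixes i.
Proof.
elim: i => [|i ih]; first by rewrite /pre.
rewrite preS //= mem_cat; case: ifP => _; last by rewrite ih.
by apply/orP; right; exact: map_f.
Qed.

Lemma uniq_prefixes i : uniq (prefixes i).
Proof.
elim: i => //= i ih; rewrite cat_uniq ih map_inj_uniq ?ih ?andbT /=; last first.
  exact: rcons_injl.
apply/hasPn => _ /mapP[t _ ->]; apply/negP => /admissible_prefixes /and3P[_ _].
by rewrite all_rcons ltnn andbF.
Qed.

(** * Recursive expectations of functions of a prefix *)

Section expectation.
Variable R : realType.
Implicit Types (f g : seq nat -> R) (s : seq nat).

(** Conditional expectation of [f (pre n.+1 alpha)] given [pre n alpha = s]. *)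
Definition step n f s : R :=
  survival R s * f (rcons s n) + (1 - survival R s) * f s.

(* [expect i f] is the expectation of [f (pre i.+2 alpha)]. *)
Fixpoint expect (i : nat) f : R :=
  if i is j.+1 then expect j (step j.+2 f) else f [::].

Lemma survival_rcons s n :
  survival R (rcons s n) = survival R s * (1 - n%:R^-1).
Proof. by rewrite /survival -cats1 big_cat big_seq1. Qed.

Lemma inv_nat_itv n : (2 <= n)%N -> 0 < (n%:R^-1 : R) < 1.
Proof.
move=> n2; rewrite invr_gt0 ltr0n (ltnW n2) /= invf_lt1 ?ltr1n//.
by rewrite ltr0n ltnW.
Qed.

Lemma survival_itv s n : admissible s n -> 0 < survival R s <= 1.
Proof.
case/and3P=> _ _; rewrite /survival; elim: s => [|a s ih] /=.
  by rewrite big_nil ltr01 lexx.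
case/andP=> /andP[/inv_nat_itv a2 _] /ih /andP[p0 p1]; rewrite big_cons.
by apply/andP; split; nra.
Qed.

Lemma survival_ge0 s n : admissible s n -> 0 <= survival R s.
Proof. by move=> /survival_itv /andP[/ltW]. Qed.

Lemma survival_le1 s n : admissible s n -> survival R s <= 1.
Proof. by move=> /survival_itv /andP[]. Qed.

Lemma step_ge0 n f : (forall s, admissible s n.+1 -> 0 <= f s) ->
  forall s, admissible s n -> 0 <= step n f s.
Proof.
move=> f0 s sn; rewrite addr_ge0 ?mulr_ge0 ?subr_ge0 ?f0 //.
- exact: survival_ge0 sn.
- exact: admissible_rcons.
- exact: survival_le1 sn.
- exact: admissibleS.
Qed.

(** Only admissible lists are reached from the empty one, so identities under [expect] may use that
    [survival] is positive and at most 1. *)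
Lemma eq_expect i f g : (forall s, admissible s i.+2 -> f s = g s) ->
  expect i f = expect i g.
Proof.
elim: i f g => [|i ih] f g fg /=; first exact: fg.
apply: ih => s si; rewrite /step !fg //; first exact: admissibleS.
exact: admissible_rcons.
Qed.

Lemma expectD i f g : expect i (fun s => f s + g s) = expect i f + expect i g.
Proof.
elim: i f g => [|i ih] f g //=; rewrite -ih; apply: eq_expect => s _.
by rewrite /step; ring.
Qed.

Lemma expectZ i c f : expect i (fun s => c * f s) = c * expect i f.
Proof.
elim: i f => [|i ih] f //=; rewrite -ih; apply: eq_expect => s _.
by rewrite /step; ring.
Qed.

Lemma expect_cst i (c : R) : expect i (fun=> c) = c.
Proof.
elim: i => //= i ih; rewrite -[RHS]ih; apply: eq_expect => s _; rewrite /step; ring.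
Qed.

Lemma expect_ge0 i f : (forall s, admissible s i.+2 -> 0 <= f s) ->
  0 <= expect i f.
Proof.
elim: i f => [|i ih] f f0 /=; first exact: f0.
by apply: ih; exact: step_ge0.
Qed.

Lemma ler_expect i f g : (forall s, admissible s i.+2 -> f s <= g s) ->
  expect i f <= expect i g.
Proof.
move=> fg; rewrite -subr_ge0 -mulN1r -expectZ -expectD.
by apply: expect_ge0 => s /fg; rewrite mulN1r subr_ge0.
Qed.

(** * From recursive expectations to integrals against the measure *)

Section bridge.
Variable mu : probability sieve_space R.
Hypothesis mu_hawkins : hawkins_measure mu.

Lemma measurable_elementary s n : admissible s n ->
  measurable (elementary s n : set sieve_space).
Proof. by move=> sn; apply: sub_sigma_algebra; exists s, n. Qed.

(** The defining equations of the measure split the mass of each prefix as [step] does: including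
    the next integer has weight [survival R s], omitting it the complementary weight. *)
Lemma sum_prefixes i f :
  (\sum_(s <- prefixes i) (f s)%:E * mu (elementary s i.+2) = (expect i f)%:E)%E.
Proof.
case: mu_hawkins => mu0 muin muout.
elim: i f => [|i ih] f /=; first by rewrite big_seq1 mu0 mule1.
rewrite -ih big_cat big_map /= -big_split /=; apply: eq_big_seq => s /admissible_prefixes si.
rewrite (muin _ _ si) (muout _ _ si).
set m := mu _.
have /fineK <- : m \is a fin_num.
  by apply: fin_num_measure; exact: measurable_elementary.
by rewrite -!EFinM -!EFinD /step; congr EFin; ring.
Qed.

(** The admissibility test makes this measurable for every list [s], so that sums over lists need no
    side condition. *)
Definition weighted_indic i f s (alpha : sieve_space) : \bar R :=
  if admissible s i.+2
  then ((f s)%:E * (\1_(elementary s i.+2 : set sieve_space) alpha)%:E)%E else 0%E.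

Lemma measurable_weighted_indic i f s :
  measurable_fun setT (weighted_indic i f s).
Proof.
rewrite /weighted_indic; case si: (admissible s i.+2); last exact: measurable_cst.
apply: measurable_funeM; apply/measurable_EFinP.
by apply: measurable_indic; exact: measurable_elementary.
Qed.

Lemma pre_indic_sum i f (alpha : sieve_space) :
  (f (pre i.+2 alpha))%:E = (\sum_(s <- prefixes i) weighted_indic i f s alpha)%E.
Proof.
rewrite (bigD1_seq (pre i.+2 alpha)) ?pre_prefixes ?uniq_prefixes //=.
rewrite big_seq_cond big1 ?adde0 /weighted_indic.
  by rewrite admissible_pre // elementaryE ?admissible_pre // indicE mem_set // mule1.
move=> s /andP[/admissible_prefixes si sne].
rewrite si elementaryE // indicE memNset ?mule0 //= => e.
by move: sne; rewrite -e eqxx.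
Qed.

Lemma measurable_pre i f :
  measurable_fun setT ((fun alpha => (f (pre i.+2 alpha))%:E) : sieve_space -> \bar R).
Proof.
apply: (eq_measurable_fun (fun alpha => \sum_(s <- prefixes i) weighted_indic i f s alpha)%E).
  by move=> alpha _; rewrite pre_indic_sum.
by apply: emeasurable_sum => s; exact: measurable_weighted_indic.
Qed.

Lemma integral_pre i f : (forall s, 0 <= f s) ->
  (\int[mu]_alpha (f (pre i.+2 alpha))%:E = (expect i f)%:E)%E.
Proof.
move=> f0; rewrite -sum_prefixes.
under eq_integral do rewrite pre_indic_sum.
rewrite ge0_integral_sum //.
- apply: eq_big_seq => s /admissible_prefixes si; rewrite /weighted_indic si.
  rewrite ge0_integralZl //.
  + by rewrite integral_indic ?setIT//; exact: measurable_elementary.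
  + apply/measurable_EFinP.
    by apply: measurable_indic; exact: measurable_elementary.
  + by rewrite lee_fin f0.
- by move=> s; exact: measurable_weighted_indic.
- move=> s alpha _; rewrite /weighted_indic; case: ifP => // _.
  by rewrite mule_ge0 ?lee_fin ?f0.
Qed.

(** The expectations have bounded partial sums, so by monotone convergence the random series has a
    finite integral; it converges almost everywhere and its terms tend to 0. *)
Lemma ae_cvg0 (idx : nat -> nat) (f : nat -> seq nat -> R) (c : nat -> R) (C : R) :
  (forall k s, 0 <= f k s) ->
  (forall k, expect (idx k) (f k) <= c k) ->
  (forall n, \sum_(0 <= k < n) c k <= C) ->
  {ae mu, forall alpha : sieve_space,
    f k (pre (idx k).+2 alpha) @[k --> \oo] --> (0 : R)}.
Proof.
move=> f0 fc cC.
pose F k (alpha : sieve_space) : \bar R := (f k (pre (idx k).+2 alpha))%:E.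
have F0 k alpha : (0 <= F k alpha)%E by rewrite lee_fin.
have mF k : measurable_fun setT (F k) by exact: measurable_pre.
have iF : (\int[mu]_alpha (\sum_(0 <= k <oo) F k alpha) <= C%:E)%E.
  rewrite integral_nneseries //.
  apply: lime_le.
    by apply: is_cvg_nneseries => k _ _; exact: integral_ge0.
  apply: nearW => n; apply: (@le_trans _ _ (\sum_(0 <= k < n) c k)%:E); last by rewrite lee_fin.
  rewrite -sumEFin; apply: lee_sum => k _.
  by rewrite integral_pre // lee_fin.
have intF : mu.-integrable setT (fun alpha => \sum_(0 <= k <oo) F k alpha)%E.
  apply/integrableP; split; first exact: ge0_emeasurable_sum.
  under eq_integral do rewrite gee0_abs ?nneseries_ge0//.
  by apply: le_lt_trans iF _; rewrite ltry.
apply: filterS (integrable_ae measurableT intF) => alpha /(_ Logic.I) Ffin.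
apply: cvg_series_cvg_0; apply: nondecreasing_is_cvgn.
  by apply/nondecreasing_seqP => n; rewrite seriesSr lerDl.
exists (fine (\sum_(0 <= k <oo) F k alpha)%E) => _ [n _ <-].
rewrite -lee_fin fineK // /series /= -sumEFin.
by apply: (@nneseries_lim_ge _ (F ^~ alpha) xpredT) => k _ _; exact: F0.
Qed.

End bridge.
End expectation.

(** * Almost sure bounds from second moments *)

Lemma filter_lt_rcons s m n : (n <= m)%N ->
  [seq a <- rcons s m | (a < n)%N] = [seq a <- s | (a < n)%N].
Proof. by move=> nm; rewrite filter_rcons ltnNge nm. Qed.

Lemma filter_lt_admissible s n : admissible s n -> [seq a <- s | (a < n)%N] = s.
Proof.
case/and3P=> _ _ /allP sn; apply/all_filterP/allP => a /sn.
by case/andP.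
Qed.

Lemma filter_lt_pre m n alpha : (m <= n)%N ->
  [seq a <- pre n alpha | (a < m)%N] = pre m alpha.
Proof.
move=> mn; apply: (irr_sorted_eq ltn_trans ltnn).
- apply: (sorted_filter ltn_trans); apply: (sorted_filter ltn_trans).
  exact: iota_ltn_sorted.
- by apply: (sorted_filter ltn_trans); exact: iota_ltn_sorted.
move=> a; rewrite mem_filter !mem_pre andbA; congr (_ && _); apply/idP/idP; lia.
Qed.

Lemma expr_cvg0 (R : realType) (T : Type) (F : set_system T) {FF : Filter F}
    (u : T -> R) n : (0 < n)%N ->
  u x ^+ n @[x --> F] --> (0 : R) -> u x @[x --> F] --> (0 : R).
Proof.
move=> n0 /cvgr0Pnorm_lt un; apply/cvgr0Pnorm_lt => e e0.
have := un _ (exprn_gt0 n e0); apply: filterS => x.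
by rewrite normrX ltr_pXn2r // nnegrE ltW.
Qed.

Section second_moments.
Variable R : realType.
Implicit Types (s : seq nat) (p : nat -> seq nat -> R).

Lemma sum_inv_sqr_le n : \sum_(0 <= k < n) (k.+1%:R ^+ 2)^-1 <= 2 :> R.
Proof.
case: n => [|n]; first by rewrite big_nil.
(* The extra term [1/(n+1)] dominates the tail of the series and lets the induction go through. *)
suff : \sum_(0 <= k < n.+1) (k.+1%:R ^+ 2)^-1 + n.+1%:R^-1 <= 2 :> R.
  by apply: le_trans; rewrite lerDl invr_ge0.
elim: n => [|n ih]; first by rewrite big_nat1 expr1n invr1; lra.
rewrite big_nat_recr //=; apply: le_trans ih; rewrite -addrA lerD2l.
have n1 : 0 < n.+1%:R :> R by rewrite ltr0n.
rewrite -[in n.+2%:R]addn1 natrD; set x : R := n.+1%:R in n1 *.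
rewrite -subr_ge0.
have -> : x^-1 - (((x + 1) ^+ 2)^-1 + (x + 1)^-1) = (x * (x + 1) ^+ 2)^-1.
  by field; lra.
by rewrite invr_ge0 mulr_ge0 ?exprn_ge0 //; lra.
Qed.

(** The martingale with predictable weights [p]. Earlier prefixes are recovered from [s] by
    filtering, so that this is a function of the last prefix alone and [expect] applies. *)
Definition mart p i s : R :=
  \sum_(0 <= j < i) p j.+2 [seq a <- s | (a < j.+2)%N] *
    ((j.+2 \in s)%:R - survival R [seq a <- s | (a < j.+2)%N]).

Lemma mart_rcons p i s : admissible s i.+2 ->
  mart p i.+1 (rcons s i.+2) = mart p i s + p i.+2 s * (1 - survival R s).
Proof.
move=> si; rewrite /mart big_nat_recr //= filter_lt_rcons // filter_lt_admissible //.
rewrite mem_rcons inE eqxx; congr (_ + _); apply: eq_big_nat => j /andP[_ ji].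
rewrite filter_lt_rcons; last by rewrite !ltnS ltnW.
by rewrite mem_rcons inE eqSS eqSS ltn_eqF.
Qed.

Lemma martS p i s : admissible s i.+2 ->
  mart p i.+1 s = mart p i s - p i.+2 s * survival R s.
Proof.
move=> si; rewrite /mart big_nat_recr //= filter_lt_admissible //.
case: (boolP (i.+2 \in s)) => [|_]; last by rewrite sub0r mulrN.
by case/and3P: si => _ _ /allP sn /sn; rewrite ltnn andbF.
Qed.

(** Increments have conditional mean 0, so the cross term vanishes and each step adds only the
    conditional variance [p^2 y (1 - y) <= 1]. *)
Lemma expect_mart_sqr p i :
  (forall n s, admissible s n -> `|p n s| <= 1) ->
  expect i (fun s => mart p i s ^+ 2) <= i%:R.
Proof.
move=> p1; elim: i => [|i ih] /=; first by rewrite /mart big_nil expr0n.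
have -> : i.+1%:R = i%:R + 1 :> R by rewrite -[i.+1]addn1 natrD.
apply: le_trans (lerD ih (lexx _)); rewrite -(@expect_cst R i 1) -expectD.
apply: ler_expect => s si; rewrite /step mart_rcons // martS //.
have /andP[y0 y1] := survival_itv R si.
have : p i.+2 s ^+ 2 <= 1 by rewrite -real_normK ?num_real // expr_le1 ?p1.
move: (p i.+2 s) (mart p i s) (survival R s) y0 y1 => q m y y0 y1 q1.
have -> : y * (m + q * (1 - y)) ^+ 2 + (1 - y) * (m - q * y) ^+ 2 =
   m ^+ 2 + q ^+ 2 * (y * (1 - y)) by ring.
rewrite lerD2l; apply: le_trans (_ : 1 * 1 <= _); last by rewrite mulr1.
by apply: ler_pM => //; [exact: sqr_ge0|nra|nra].
Qed.

(** * Moments of the inverse survival probability *)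

Definition harm i : R := \sum_(0 <= j < i) j.+1%:R^-1.

Lemma harmS i : harm i.+1 = harm i + i.+1%:R^-1.
Proof. by rewrite /harm big_nat_recr. Qed.

Lemma harm_ge0 i : 0 <= harm i.
Proof. by apply: sumr_ge0 => j _; rewrite invr_ge0. Qed.

Lemma survival_inv_rcons s i : (survival R (rcons s i.+2))^-1 =
  (survival R s)^-1 * (1 + i.+1%:R^-1).
Proof.
rewrite survival_rcons invfM; congr (_ * _).
have i0 : 0 < i.+1%:R :> R by rewrite ltr0n.
rewrite -[i.+2]addn1 natrD; move: (i.+1%:R : R) i0 => x x0.
by field; lra.
Qed.

(** The inverse is multiplied by [1 + 1/(i+1)] with probability [survival R s], hence grows by
    [1/(i+1)] on average. *)
Lemma expect_survival_inv i : expect i (fun s => (survival R s)^-1) = 1 + harm i.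
Proof.
elim: i => [|i ih] /=; first by rewrite /harm /survival !big_nil invr1 addr0.
rewrite harmS addrA -ih -(@expect_cst R i i.+1%:R^-1) -expectD.
apply: eq_expect => s /(survival_itv R)/andP[s0 _].
rewrite /step survival_inv_rcons; set y := survival R s in s0 *.
rewrite mulrA divff ?gt_eqF // mulrBl divff ?gt_eqF // -/y; ring.
Qed.

Lemma expect_inv_survival_sqr i :
  expect i (fun s => ((survival R s)^-1 - 1 - harm i) ^+ 2) <= 2.
Proof.
case: i => [|i].
  by rewrite /= /harm /survival !big_nil invr1 subrr subr0 expr0n.
(* The subtracted slack carries the induction: it shrinks by at least [H_j/(j+1)^2], the second
   moment gained at each step. *)
suff : expect i.+1 (fun s => ((survival R s)^-1 - 1 - harm i.+1) ^+ 2) <=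
    2 - (harm i.+1 + 1) / i.+1%:R.
  move=> /le_trans; apply; rewrite gerBl divr_ge0 // addr_ge0 ?harm_ge0 //.
(* The conditional variance of one martingale step is [(1/Y - 1)/(j+1)^2], whose mean is
   [H_j/(j+1)^2]. *)
have stepE j : expect j.+1 (fun s => ((survival R s)^-1 - 1 - harm j.+1) ^+ 2) =
    expect j (fun s => ((survival R s)^-1 - 1 - harm j) ^+ 2) +
    harm j * (j.+1%:R ^+ 2)^-1.
  have -> : harm j * (j.+1%:R ^+ 2)^-1 =
      (j.+1%:R ^+ 2)^-1 * (expect j (fun s => (survival R s)^-1) + -1).
    by rewrite expect_survival_inv; ring.
  rewrite -(@expect_cst R j (-1)) -expectD -expectZ -expectD /=.
  apply: eq_expect => s /(survival_itv R)/andP[s0 _].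
  rewrite /step survival_inv_rcons harmS.
  have j0 : 0 < j.+1%:R :> R by rewrite ltr0n.
  move: (survival R s) (j.+1%:R : R) s0 j0 => y x y0 x0.
  by field; lra.
elim: i => [|i ih]; rewrite stepE.
  rewrite /= /harm /survival !big_nil big_nat1 invr1 subrr subr0 expr0n /= mul0r add0r; lra.
apply: le_trans (lerD ih (lexx _)) _; rewrite [harm i.+2]harmS -subr_ge0.
have h0 := harm_ge0 i.+1.
have i0 : 0 < i.+1%:R :> R by rewrite ltr0n.
rewrite -[i.+2]addn1 natrD; move: (harm i.+1) (i.+1%:R : R) h0 i0 => h x h0 x0.
have -> : 2 - (h + (x + 1)^-1 + 1) / (x + 1) -
   (2 - (h + 1) / x + h * ((x + 1) ^+ 2)^-1) = (h + 1) / (x * (x + 1) ^+ 2).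
  by field; lra.
by rewrite divr_ge0 ?mulr_ge0 ?exprn_ge0 //; lra.
Qed.

(** * Almost sure limits along sparse subsequences *)

Section ae.
Variable mu : probability sieve_space R.
Hypothesis mu_hawkins : hawkins_measure mu.

(** At [n = 2^k] the logarithm has order [k]; the bounded second moments divided by [(k+1)^2] are
    summable. *)
Lemma ae_inv_survival :
  {ae mu, forall alpha : sieve_space,
    (((survival R (pre (2 ^ k).+2 alpha))^-1 - 1 - harm (2 ^ k)%N) / k.+1%:R)
      @[k --> \oo] --> (0 : R)}.
Proof.
apply: (filterS _ (@ae_cvg0 R mu mu_hawkins (fun k => 2 ^ k)%N
  (fun k s => (((survival R s)^-1 - 1 - harm (2 ^ k)%N) / k.+1%:R) ^+ 2)
  (fun k => 2 / k.+1%:R ^+ 2) 4 _ _ _)).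
- by move=> alpha; exact: (@expr_cvg0 _ _ _ _ _ 2).
- by move=> k s; exact: sqr_ge0.
- move=> k; under eq_expect do rewrite exprMn mulrC exprVn.
  by rewrite expectZ mulrC ler_wpM2r ?invr_ge0 ?sqr_ge0 // expect_inv_survival_sqr.
- by move=> n; rewrite -mulr_sumr; have := sum_inv_sqr_le n; lra.
Qed.

(** The second moment [k^4] over [(k+1)^6] is summable. Fourth powers are sparse enough for this,
    and their gaps are still of order [k^3], the size of the normalisation. *)
Lemma ae_mart p : (forall n s, admissible s n -> `|p n s| <= 1) ->
  {ae mu, forall alpha : sieve_space,
    (mart p (k ^ 4) (pre (k ^ 4).+2 alpha) / k.+1%:R ^+ 3)
      @[k --> \oo] --> (0 : R)}.
Proof.
move=> p1.
apply: (filterS _ (@ae_cvg0 R mu mu_hawkins (fun k => k ^ 4)%N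
  (fun k s => (mart p (k ^ 4) s / k.+1%:R ^+ 3) ^+ 2)
  (fun k => (k.+1%:R ^+ 2)^-1) 2 _ _ _)).
- by move=> alpha; exact: (@expr_cvg0 _ _ _ _ _ 2).
- by move=> k s; exact: sqr_ge0.
- move=> k; under eq_expect do rewrite exprMn mulrC exprVn.
  rewrite expectZ -exprM mulrC.
  have k0 : 0 < k.+1%:R :> R by rewrite ltr0n.
  rewrite ler_pdivrMr ?exprn_gt0 // (_ : (3 * 2 = 2 + 4)%N) // exprD mulKf; last first.
    by rewrite expf_eq0 gt_eqF.
  apply: le_trans (expect_mart_sqr _ p1) _.
  by rewrite -natrX ler_nat leq_exp2r.
- exact: sum_inv_sqr_le.
Qed.

Lemma mart_pre p i alpha : mart p i (pre i.+2 alpha) =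
  \sum_(0 <= j < i) p j.+2 (pre j.+2 alpha) *
    (`[< terms alpha j.+2 >]%:R - survival R (pre j.+2 alpha)).
Proof.
apply: eq_big_nat => j /andP[_ ji]; rewrite filter_lt_pre ?mem_pre; last first.
  by rewrite !ltnS ltnW.
by rewrite !ltnS ji.
Qed.

End ae.
End second_moments.

(** * Deterministic asymptotics *)

Section asymptotics.
Variable R : realType.
Implicit Types (u Y M : nat -> R) (l n k : nat).

Lemma cvgr_ln_pinfty : @ln R x @[x --> +oo] --> +oo.
Proof.
apply/cvgryPge => A; near=> x.
rewrite -ler_expR lnK; last by rewrite posrE; near: x; exact: nbhs_pinfty_gt.
by near: x; exact: nbhs_pinfty_ge.
Unshelve. all: by end_near. Qed.

Lemma cvg_inv_pinfty (T : Type) (F : set_system T) {FF : Filter F} (f : T -> R) :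
  f x @[x --> F] --> +oo -> (f x)^-1 @[x --> F] --> (0 : R).
Proof.
move=> foo; apply/gtr0_cvgV0 => //.
by have /cvgryPgt := foo; apply.
Qed.

(** The term of degree [l+1] of the exponential series at [ln x] bounds the quotient by
    [(l+1)!/ln x]. *)
Lemma cvg_ln_expr_div l : (ln x ^+ l / x : R) @[x --> +oo] --> (0 : R).
Proof.
apply: (@squeeze_cvgr _ _ _ _ (cst 0) (fun x => (l.+1)`!%:R * (ln x)^-1)).
- near=> x; have x1 : 1 < x by near: x; exact: nbhs_pinfty_gt.
  have x0 : 0 < x by apply: lt_trans x1.
  have lx := ln_gt0 x1.
  apply/andP; split; first by rewrite divr_ge0 ?exprn_ge0 // ltW.
  rewrite ler_pdivrMr //.
  have := @expR_ge1Dxn R (ln x) l (ltW lx); rewrite lnK ?posrE // => h.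
  have {}h : ln x ^+ l.+1 <= x * (l.+1)`!%:R.
    by rewrite -ler_pdivrMr ?ltr0n ?fact_gt0 //; lra.
  by rewrite mulrAC ler_pdivlMr // -exprSr mulrC.
- exact: cvg_cst.
- rewrite -[X in _ --> X](mulr0 ((l.+1)`!%:R : R)); apply: cvgMl_tmp.
  by apply: cvg_inv_pinfty; exact: cvgr_ln_pinfty.
Unshelve. all: by end_near. Qed.

Lemma cvg_lnn_expr_div l : (ln n%:R ^+ l / n%:R : R) @[n --> \oo] --> (0 : R).
Proof. exact: (cvg_comp _ _ (@cvgr_idn R) (cvg_ln_expr_div l)). Qed.

Lemma cvg_lnn_pinfty : @ln R n%:R @[n --> \oo] --> +oo.
Proof. exact: (cvg_comp _ _ (@cvgr_idn R) cvgr_ln_pinfty). Qed.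

Lemma cvg_lnn_inv : (@ln R n%:R)^-1 @[n --> \oo] --> (0 : R).
Proof. by apply: cvg_inv_pinfty; exact: cvg_lnn_pinfty. Qed.

Lemma cvg_natr_inv : (n%:R^-1 : R) @[n --> \oo] --> (0 : R).
Proof. by apply: cvg_inv_pinfty; exact: cvgr_idn. Qed.

Lemma cvg_ln_lnn_div : (ln (ln n%:R) / ln n%:R : R) @[n --> \oo] --> (0 : R).
Proof.
have := cvg_comp _ _ cvg_lnn_pinfty (cvg_ln_expr_div 1).
by under eq_fun do rewrite expr1.
Qed.

Lemma cvg_expr_n (T : Type) (F : set_system T) {FF : Filter F} (f : T -> R) l (a : R) :
  f x @[x --> F] --> a -> f x ^+ l @[x --> F] --> a ^+ l.
Proof.
move=> fa; elim: l => [|l ih]; first by under eq_fun do rewrite expr0; exact: cvg_cst.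
by rewrite exprS; under eq_fun do rewrite exprS; exact: cvgM.
Qed.

(** * Sums of powers of a decreasing sequence equivalent to [1/ln n] *)

Section power_sum.
Variables (Y : nat -> R) (l : nat).
Hypothesis Y_gt0 : forall n, (2 <= n)%N -> 0 < Y n.
Hypothesis Y_le1 : forall n, (2 <= n)%N -> Y n <= 1.
Hypothesis Y_ninc : forall m n, (2 <= m <= n)%N -> Y n <= Y m.
Hypothesis Y_ln : Y n * ln n%:R @[n --> \oo] --> (1 : R).

Let Y_ge0 n (n2 : (2 <= n)%N) : 0 <= Y n := ltW (Y_gt0 n2).

Let S n : R := \sum_(2 <= m < n) Y m ^+ l.

Lemma power_sum_ge n : (2 <= n)%N -> (n%:R - 2) * Y n ^+ l <= S n.
Proof.
move=> n2; rewrite -natrB // mulr_natl -sumr_const_nat.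
apply: ler_sum_nat => m /andP[m2 mn]; apply: lerXn2r; rewrite ?nnegrE ?Y_ge0 //.
by apply: Y_ninc; rewrite m2 ltnW.
Qed.

(** Below [t] each term is at most 1, from [t] on at most [Y t ^+ l]. *)
Lemma power_sum_le t n : (2 <= t)%N -> S n <= t%:R + n%:R * Y t ^+ l.
Proof.
move=> t2; have yt : 0 <= Y t ^+ l by rewrite exprn_ge0 // Y_ge0.
have [nt|tn] := leqP n t.
  apply: le_trans (_ : n%:R <= _); last by rewrite ler_wpDr ?mulr_ge0 // ler_nat.
  have [n2|n2] := leqP n 2; first by rewrite /S big_geq.
  apply: le_trans (_ : \sum_(2 <= m < n) 1 <= _).
    apply: ler_sum_nat => m /andP[m2 _]; apply: exprn_ile1; rewrite ?Y_le1 //.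
    by rewrite ?Y_ge0.
  by rewrite sumr_const_nat ler_nat leq_subr.
rewrite /S (big_cat_nat t2 (ltnW tn)) /=; apply: lerD.
  apply: le_trans (_ : \sum_(2 <= m < t) 1 <= _).
    apply: ler_sum_nat => m /andP[m2 _]; apply: exprn_ile1; rewrite ?Y_le1 //.
    by rewrite ?Y_ge0.
  by rewrite sumr_const_nat ler_nat leq_subr.
apply: le_trans (_ : \sum_(t <= m < n) Y t ^+ l <= _).
  apply: ler_sum_nat => m /andP[tm _].
  by apply: lerXn2r; rewrite ?nnegrE ?Y_ge0 ?Y_ninc ?t2 // (leq_trans t2).
by rewrite sumr_const_nat -[_ *+ (n - t)]mulr_natl ler_wpM2r // ler_nat leq_subr.
Qed.

Lemma power_sum_asymp : S n * (ln n%:R ^+ l / n%:R) @[n --> \oo] --> (1 : R).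
Proof.
pose L n : R := ln n%:R.
(* The terms below [T ~ n / L^(l+1)] are negligible, and [ln T ~ L]. *)
pose T n := (Num.truncn (n%:R / L n ^+ l.+1)).+2.
have Tu : \forall n \near \oo, n%:R / L n ^+ l.+1 < (T n)%:R.
  near=> n; apply: lt_le_trans (truncnS_gt _) _; by rewrite ler_nat.
have Too : T n @[n --> \oo] --> \oo.
  apply/cvgnyPge => A; near=> n.
  have n0 : 0 < n%:R :> R by rewrite ltr0n; near: n; exact: nbhs_infty_gt.
  have L0 : 0 < L n by near: n; exact: (cvgryPgt _).1 cvg_lnn_pinfty 0.
  have : L n ^+ l.+1 / n%:R < A.+1%:R^-1.
    near: n; apply: (cvgr_lt _ (cvg_lnn_expr_div l.+1)).
    by rewrite invr_gt0 ltr0n.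
  rewrite ltr_pdivrMr // mulrC ltr_pdivlMr ?ltr0n // mulrC -ltr_pdivlMr ?exprn_gt0 // => h.
  apply: leq_trans (_ : A <= (Num.truncn (n%:R / L n ^+ l.+1)))%N _; last by rewrite /T; lia.
  rewrite truncn_ge_nat; last by rewrite divr_ge0 ?exprn_ge0 // ltW.
  by apply: le_trans (ltW h); rewrite ler_nat.
(* In the upper bound, [1/L] and [2 L^l/n] come from [T <= n/L^(l+1) + 2], which bounds the
   contribution below [T]; the last factor bounds [(L / ln T)^l], since [ln T >= L - (l+1) ln L]. *)
apply: (@squeeze_cvgr _ _ _ _ (fun n => (1 - 2 / n%:R) * (Y n * L n) ^+ l)
  (fun n => (L n)^-1 + 2 * (L n ^+ l / n%:R) +
     (Y (T n) * ln (T n)%:R) ^+ l * ((1 - l.+1%:R * (ln (L n) / L n))^-1) ^+ l)).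
- near=> n.
  have n2 : (2 <= n)%N by near: n; exact: nbhs_infty_ge.
  have n0 : 0 < n%:R :> R by rewrite ltr0n ltnW.
  have L1 : 1 < L n by near: n; exact: (cvgryPgt _).1 cvg_lnn_pinfty 1.
  have L0 : 0 < L n by apply: lt_trans L1.
  have w0 : 0 <= L n ^+ l / n%:R by rewrite divr_ge0 ?exprn_ge0 // ltW.
  apply/andP; split.
    apply: le_trans (ler_wpM2r w0 (power_sum_ge n2)).
    rewrite le_eqVlt; apply/orP; left; apply/eqP.
    rewrite exprMn; field; lra.
  apply: le_trans (ler_wpM2r w0 (@power_sum_le (T n) n _)) _ => //.
  have d0 : 0 < 1 - l.+1%:R * (ln (L n) / L n).
    rewrite subr_gt0 mulrC -ltr_pdivlMr ?ltr0n // div1r.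
    near: n; apply: (cvgr_lt _ cvg_ln_lnn_div).
    by rewrite invr_gt0 ltr0n.
  have u0 : 0 < n%:R / L n ^+ l.+1 by rewrite divr_gt0 ?exprn_gt0.
  have Tle : (T n)%:R <= n%:R / L n ^+ l.+1 + 2 :> R.
    by rewrite /T -addn2 natrD lerD2r truncn_le ltW.
  have Tlt : n%:R / L n ^+ l.+1 < (T n)%:R by near: n.
  have lnT : L n * (1 - l.+1%:R * (ln (L n) / L n)) <= ln (T n)%:R.
    apply: le_trans (_ : ln (n%:R / L n ^+ l.+1) <= _); last first.
      by rewrite ler_ln ?posrE ?ltW // ltr0n.
    rewrite ln_div ?posrE ?exprn_gt0 // lnXn // -mulr_natl.
    rewrite le_eqVlt; apply/orP; left; apply/eqP; rewrite -/(L n); field; lra.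
  rewrite mulrDl; apply: lerD.
    apply: le_trans (ler_wpM2r w0 Tle) _; rewrite mulrDl lerD2r.
    rewrite le_eqVlt; apply/orP; left; apply/eqP; rewrite exprS; field.
    by rewrite expf_eq0; lra.
  have -> : n%:R * Y (T n) ^+ l * (ln n%:R ^+ l / n%:R) = (Y (T n) * L n) ^+ l.
    by rewrite exprMn; field; lra.
  rewrite -exprMn; apply: lerXn2r.
  + by rewrite nnegrE mulr_ge0 ?Y_ge0 // ltW.
  + by rewrite nnegrE !mulr_ge0 ?invr_ge0 ?Y_ge0 ?(ltW d0) // ln_ge0 // ler1n.
  rewrite -mulrA ler_wpM2l ?Y_ge0 //.
  by rewrite ler_pdivlMr.
- rewrite -[X in _ --> X](_ : (1 - 2 * 0) * 1 ^+ l = 1); last by rewrite expr1n; ring.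
  apply: cvgM; last exact: cvg_expr_n.
  by apply: cvgB; [exact: cvg_cst | apply: cvgMl_tmp; exact: cvg_natr_inv].
- rewrite -[X in _ --> X](_ : 0 + 2 * 0 + 1 ^+ l * ((1 - l.+1%:R * 0)^-1) ^+ l = 1); last first.
    by rewrite !mulr0 subr0 invr1 !expr1n; ring.
  apply: cvgD.
    apply: cvgD; first exact: cvg_lnn_inv.
    by apply: cvgMl_tmp; exact: cvg_lnn_expr_div.
  apply: cvgM.
    apply: cvg_expr_n; exact: (cvg_comp _ _ Too Y_ln).
  apply: cvg_expr_n; apply: cvgV; first by rewrite mulr0 subr0 oner_eq0.
  apply: cvgB; first exact: cvg_cst.
  by apply: cvgMl_tmp; exact: cvg_ln_lnn_div.
Unshelve. all: by end_near. Qed.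

End power_sum.
End asymptotics.

(** * Interpolation between sparse indices *)

Section interpolation.
Variable R : realType.
Implicit Types (Y M : nat -> R) (l n k : nat).

Lemma exists_root4 n : exists k, (k ^ 4 <= n < k.+1 ^ 4)%N.
Proof.
elim: n => [|n [k /andP[kn nk]]]; first by exists 0%N.
have [h|h] := ltnP n.+1 (k.+1 ^ 4); first by exists k; rewrite h andbT ltnW.
exists k.+1; rewrite h /=; apply: leq_ltn_trans nk _.
by rewrite ltn_exp2r.
Qed.

Lemma lipschitz_dist M m n : (forall i, `|M i.+1 - M i| <= 1) -> (m <= n)%N ->
  `|M n - M m| <= n%:R - m%:R.
Proof.
move=> M1 /subnKC <-; elim: (n - m)%N => [|d ih].
  by rewrite addn0 !subrr normr0.
rewrite addnS (le_trans (ler_distD (M (m + d)%N) _ _)) //.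
have -> : (m + d).+1%:R - m%:R = 1 + ((m + d)%:R - m%:R) :> R.
  by rewrite -[(m + d).+1]addn1 natrD; ring.
exact: lerD.
Qed.

(** From [k^4] to [n] the sequence moves by at most [4 (k+1)^3], whence the 5; and
    [(k+1)^4 <= 16 k^4 <= 16 n]. Fourth powers avoid the fractional exponent in [n^(3/4)]. *)
Lemma lipschitz_fourth_power M n k : (forall i, `|M i.+1 - M i| <= 1) ->
  (0 < k)%N -> (k ^ 4 <= n < k.+1 ^ 4)%N -> `|M (k ^ 4)%N| <= k.+1%:R ^+ 3 ->
  M n ^+ 4 <= 5 ^+ 4 * 16 ^+ 3 * n%:R ^+ 3.
Proof.
move=> M1 k0 /andP[kn nk] Mk.
have Mn : `|M n| <= 5 * k.+1%:R ^+ 3.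
  rewrite -[M n](subrK (M (k ^ 4)%N)) (le_trans (ler_normD _ _)) //.
  have : `|M n - M (k ^ 4)%N| <= 4 * k.+1%:R ^+ 3; last by lra.
  apply: le_trans (lipschitz_dist M1 kn) _.
  have : (n%:R : R) <= (k.+1%:R) ^+ 4 by rewrite -natrX ler_nat ltnW.
  rewrite natrX -[k.+1]addn1 natrD; have : 0 <= k%:R :> R by [].
  by move: (k%:R : R) (n%:R : R) => x y x0; nra.
have -> : M n ^+ 4 = `|M n| ^+ 4 by rewrite -normrX ger0_norm // (exprM _ 2 2) sqr_ge0.
apply: le_trans (_ : (5 * k.+1%:R ^+ 3) ^+ 4 <= _).
  by apply: lerXn2r => //; rewrite nnegrE ?mulr_ge0 ?exprn_ge0.
have x4 : k.+1%:R ^+ 4 <= 16 * n%:R :> R.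
  apply: le_trans (_ : (2 * k%:R) ^+ 4 <= _).
    apply: lerXn2r; rewrite ?nnegrE ?mulr_ge0 //.
    by rewrite -natrM ler_nat; lia.
  have -> : (2 * k%:R) ^+ 4 = 16 * k%:R ^+ 4 :> R by ring.
  by rewrite ler_wpM2l // -natrX ler_nat.
have -> : (5 * k.+1%:R ^+ 3) ^+ 4 = 5 ^+ 4 * (k.+1%:R ^+ 4) ^+ 3 :> R.
  by rewrite exprMn -!exprM.
rewrite -mulrA ler_wpM2l ?exprn_ge0 // -exprMn.
by apply: lerXn2r; rewrite ?nnegrE ?mulr_ge0 ?exprn_ge0.
Qed.

(** Since [M n] is [O(n^(3/4))], the fourth power of the product is at most a constant times
    [(ln n)^(4l)/n]. *)
Lemma lipschitz_negligible M c d l : (forall i, `|M i.+1 - M i| <= 1) ->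
  M (k ^ 4)%N / k.+1%:R ^+ 3 @[k --> \oo] --> (0 : R) ->
  M (n + c - d)%N * (ln n%:R ^+ l / n%:R) @[n --> \oo] --> (0 : R).
Proof.
move=> M1 /cvgr0Pnorm_lt /(_ 1 ltr01) [k0 _ Mk0].
have bound n : (0 < n)%N -> (k0.+1 ^ 4 <= n)%N ->
    M n ^+ 4 <= 5 ^+ 4 * 16 ^+ 3 * n%:R ^+ 3.
  move=> n0 k0n; have [k /andP[kn nk]] := exists_root4 n.
  have k0k : (k0 < k)%N.
    by rewrite -ltnS -(@ltn_exp2r _ _ 4) // (leq_ltn_trans k0n).
  apply: (@lipschitz_fourth_power M n k) => //; rewrite ?kn //.
    exact: leq_ltn_trans k0k.
  have := Mk0 k (ltnW k0k).
  rewrite /= normrM normfV (ger0_norm (exprn_ge0 3 (ler0n R _))).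
  by rewrite ltr_pdivrMr ?exprn_gt0 ?ltr0n // mul1r => /ltW.
apply: (@expr_cvg0 _ _ _ _ _ 4) => //.
set C : R := 5 ^+ 4 * 16 ^+ 3.
apply: (@squeeze_cvgr _ _ _ _ (cst 0)
   (fun n => C * c.+1%:R ^+ 3 * (ln n%:R ^+ (l * 4) / n%:R))).
- near=> n.
  have n0 : (0 < n)%N by near: n; exact: nbhs_infty_gt.
  have x0 : 0 < n%:R :> R by rewrite ltr0n.
  apply/andP; split; first by rewrite (exprM _ 2 2) sqr_ge0.
  rewrite exprMn.
  have -> : (ln n%:R ^+ l / n%:R : R) ^+ 4 = (n%:R ^+ 3)^-1 * (ln n%:R ^+ (l * 4) / n%:R).
    by rewrite exprM; field; lra.
  rewrite [leLHS]mulrA ler_wpM2r //.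
    by rewrite divr_ge0 // (mulnC l) (exprM _ 4) (exprM _ 2 2) exprn_ge0 // sqr_ge0.
  rewrite ler_pdivrMr ?exprn_gt0 // -mulrA -exprMn.
  (* Beyond this bound [n + c - d] passes the threshold in spite of truncated subtraction;
     [n + c - d <= c.+1 * n] explains the constant. *)
  have nd : (k0.+1 ^ 4 + d < n)%N by near: n; exact: nbhs_infty_gt.
  apply: le_trans (bound _ _ _) _; [lia | lia |].
  rewrite ler_wpM2l ?mulr_ge0 ?exprn_ge0 //; apply: lerXn2r; rewrite ?nnegrE ?mulr_ge0 //.
  by rewrite -natrM ler_nat; nia.
- exact: cvg_cst.
- rewrite -[X in _ --> X](mulr0 (C * c.+1%:R ^+ 3)); apply: cvgMl_tmp.
  exact: cvg_lnn_expr_div.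
Unshelve. all: by end_near. Qed.

(** * Harmonic numbers and the asymptotics of the survival probability *)

Lemma ln_le_harm n : ln n.+1%:R <= harm R n.
Proof.
elim: n => [|n ih]; first by rewrite ln1 harm_ge0.
rewrite harmS.
have n0 : 0 < n.+1%:R :> R by rewrite ltr0n.
have -> : n.+2%:R = n.+1%:R * (1 + n.+1%:R^-1) :> R.
  by rewrite mulrDr divff ?gt_eqF // mulr1 -[n.+2]addn1 natrD.
have i0 : 0 < (n.+1%:R^-1 : R) by rewrite invr_gt0.
rewrite lnM ?posrE ?addr_gt0 //.
by apply: lerD => //; apply: le_ln1Dx; apply: lt_trans i0; rewrite oppr_lt0.
Qed.

Lemma harm_le_ln n : harm R n.+1 <= 1 + ln n.+1%:R.
Proof.
elim: n => [|n ih]; first by rewrite ln1 harmS /harm big_nil invr1 add0r addr0.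
rewrite harmS; apply: le_trans (lerD ih (lexx _)) _; rewrite -addrA lerD2l.
have n0 : 0 < n.+1%:R :> R by rewrite ltr0n.
have m0 : 0 < n.+2%:R :> R by rewrite ltr0n.
have i1 : n.+2%:R^-1 < 1 :> R by rewrite invf_lt1 // ltr1n.
have -> : n.+1%:R = n.+2%:R * (1 - n.+2%:R^-1) :> R.
  by rewrite mulrBr divff ?gt_eqF // mulr1 -[n.+2]addn1 natrD addrK.
rewrite lnM ?posrE ?subr_gt0 // -addrA gerDl.
have : ln (1 - n.+2%:R^-1) <= - n.+2%:R^-1 :> R.
  by apply: le_ln1Dx; rewrite ltrN2.
move: (n.+2%:R^-1 : R) => x; lra.
Qed.

Lemma cvg_harm_pow2 : harm R (2 ^ k) / k.+1%:R @[k --> \oo] --> (ln 2 : R).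
Proof.
(* The bound [ln 2 < 2] lets the error [2/(k+1)] absorb the passage from [k] to [k+1]. *)
have l2 := @ln_sublinear R 2 ltac:(lra).
apply: (@squeeze_cvgr _ _ _ _ (fun k => ln 2 - 2 * k.+1%:R^-1)
  (fun k => ln 2 + 2 * k.+1%:R^-1)).
- apply: nearW => k.
  have k0 : 0 < k.+1%:R :> R by rewrite ltr0n.
  have p2 : (0 < 2 ^ k)%N by rewrite expn_gt0.
  have lnp : ln (2 ^ k)%:R = k%:R * ln 2 :> R by rewrite natrX lnXn // mulr_natl.
  have ge : k%:R * ln 2 <= harm R (2 ^ k).
    apply: le_trans (ln_le_harm _); rewrite -lnp ler_ln ?posrE ?ltr0n //.
    by rewrite ler_nat.
  have le : harm R (2 ^ k) <= 1 + k%:R * ln 2.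
    by rewrite -lnp -(prednK p2); exact: harm_le_ln.
  have kS : k.+1%:R = k%:R + 1 :> R by rewrite -[k.+1]addn1 natrD.
  have l20 : 0 < ln 2 :> R by apply: ln_gt0; lra.
  apply/andP; split; [rewrite ler_pdivlMr // | rewrite ler_pdivrMr //].
    have -> : (ln 2 - 2 / k.+1%:R) * k.+1%:R = ln 2 * k.+1%:R - 2 :> R by field; lra.
    by rewrite kS; lra.
  have -> : (ln 2 + 2 / k.+1%:R) * k.+1%:R = ln 2 * k.+1%:R + 2 :> R by field; lra.
  by rewrite kS; lra.
- rewrite -[X in _ --> X](_ : ln 2 - 2 * 0 = ln 2); last by rewrite mulr0 subr0.
  apply: cvgB; [exact: cvg_cst | apply: cvgMl_tmp; exact: cvg_harmonic].
- rewrite -[X in _ --> X](_ : ln 2 + 2 * 0 = ln 2); last by rewrite mulr0 addr0.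
  apply: cvgD; [exact: cvg_cst | apply: cvgMl_tmp; exact: cvg_harmonic].
Qed.

(** Along [n = 2^k + 2] the hypothesis and [H_(2^k) ~ k ln 2] determine the limit; monotonicity of
    [Y] transfers it to all [n], as [ln n] hardly changes between consecutive sample points. *)
Lemma survival_asymp Y :
  (forall n, (2 <= n)%N -> 0 < Y n) ->
  (forall m n, (2 <= m <= n)%N -> Y n <= Y m) ->
  ((Y (2 ^ k).+2)^-1 - 1 - harm R (2 ^ k)) / k.+1%:R @[k --> \oo] --> (0 : R) ->
  Y n * ln n%:R @[n --> \oo] --> (1 : R).
Proof.
move=> Y0 Yninc Ycvg.
have l20 : 0 < ln 2 :> R by apply: ln_gt0; lra.
pose a k : R := Y (2 ^ k).+2 * k.+1%:R.
have acvg : a @ \oo --> (ln 2)^-1.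
  have : (a k)^-1 @[k --> \oo] --> (0 + 1 * 0 + ln 2 : R).
    rewrite (_ : (fun k => (a k)^-1) = (fun k =>
      ((Y (2 ^ k).+2)^-1 - 1 - harm R (2 ^ k)) / k.+1%:R + 1 * k.+1%:R^-1 +
      harm R (2 ^ k) / k.+1%:R)); last first.
      by apply/funext => k; rewrite /a invfM -!mulrDl; congr (_ * _); ring.
    apply: cvgD cvg_harm_pow2; apply: cvgD Ycvg _.
    by apply: cvgMl_tmp; exact: cvg_harmonic.
  rewrite mulr0 !add0r => /(cvgV (lt0r_neq0 l20)).
  by under [X in X @ _]eq_fun do rewrite /= invrK.
(* Chosen so that [n] lies between the sample points [2^k + 2] and [2^(k+1) + 2]. *)
pose k n := trunc_log 2 (n - 2).
have koo : k n @[n --> \oo] --> \oo.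
  apply/cvgnyPge => A; near=> n.
  have : (2 ^ A + 2 <= n)%N by near: n; exact: nbhs_infty_ge.
  by move=> h; apply: trunc_log_max => //; lia.
(* The two bounds of the squeeze, from [k ln 2 <= ln n <= (k+2) ln 2]: this one is
   [Y (2^k + 2) (k+2) ln 2], the next is [Y (2^(k+1) + 2) k ln 2]. *)
have lim1 : a k * (1 + k.+1%:R^-1) * ln 2 @[k --> \oo] --> (1 : R).
  rewrite -[X in _ --> X](_ : (ln 2)^-1 * (1 + 0) * ln 2 = 1); last first.
    by rewrite addr0 mulr1 mulVf // gt_eqF.
  apply: cvgMr_tmp; apply: cvgM acvg _.
  by apply: cvgD; [exact: cvg_cst | exact: cvg_harmonic].
have lim2 : a k.+1 * (1 - 2 * k.+2%:R^-1) * ln 2 @[k --> \oo] --> (1 : R).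
  rewrite -[X in _ --> X](_ : (ln 2)^-1 * (1 - 2 * 0) * ln 2 = 1); last first.
    by rewrite mulr0 subr0 mulr1 mulVf // gt_eqF.
  apply: cvgMr_tmp; apply: cvgM; first by rewrite (cvg_shiftS a).
  apply: cvgB; [exact: cvg_cst | apply: cvgMl_tmp].
  by have := @cvg_harmonic R; rewrite -cvg_shiftS.
apply: squeeze_cvgr (cvg_comp _ _ koo lim2) (cvg_comp _ _ koo lim1).
near=> n.
have n3 : (3 <= n)%N by near: n; exact: nbhs_infty_ge.
have /andP[kn nk] : (2 ^ k n <= n - 2 < 2 ^ (k n).+1)%N.
  by rewrite trunc_logP ?trunc_log_ltn //; lia.
have lnp j : ln (2 ^ j)%:R = j%:R * ln 2 :> R by rewrite natrX lnXn // mulr_natl.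
have k0 : 0 < (k n).+1%:R :> R by rewrite ltr0n.
have k1 : 0 < (k n).+2%:R :> R by rewrite ltr0n.
have kS : (k n).+2%:R = (k n).+1%:R + 1 :> R by rewrite -[(k n).+2]addn1 natrD.
have kS' : (k n).+1%:R = (k n)%:R + 1 :> R by rewrite -[(k n).+1]addn1 natrD.
have Yn0 : 0 <= Y n by apply/ltW/Y0; lia.
have lnlo : (k n)%:R * ln 2 <= ln n%:R :> R.
  by rewrite -lnp ler_ln ?posrE ?ltr0n ?expn_gt0 ?ler_nat //; lia.
have lnhi : ln n%:R <= (k n).+2%:R * ln 2 :> R.
  rewrite -lnp ler_ln ?posrE ?ltr0n ?expn_gt0 ?ler_nat //; last by lia.
  have : (2 <= 2 ^ (k n).+1)%N by rewrite -[leqLHS]expn1 leq_exp2l.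
  rewrite (expnS 2 (k n).+1); lia.
have ylo : Y (2 ^ (k n).+1).+2 <= Y n by apply: Yninc; lia.
have yhi : Y n <= Y (2 ^ k n).+2 by apply: Yninc; lia.
apply/andP; split => /=.
  have -> : a (k n).+1 * (1 - 2 * (k n).+2%:R^-1) * ln 2 =
      Y (2 ^ (k n).+1).+2 * ((k n)%:R * ln 2).
    by rewrite /a kS kS'; field; lra.
  by apply: ler_pM => //; [exact/ltW/Y0 | rewrite mulr_ge0 // ltW].
have -> : a (k n) * (1 + (k n).+1%:R^-1) * ln 2 =
    Y (2 ^ k n).+2 * ((k n).+2%:R * ln 2).
  by rewrite /a kS kS'; field; lra.
by apply: ler_pM => //; rewrite ln_ge0 // ler1n; lia.
Unshelve. all: by end_near. Qed.

End interpolation.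

(** * Counting constellations *)

Section constellations.
Variable R : realType.
Implicit Types (alpha : sieve_seq) (r s : seq nat) (n m k c l : nat).

Local Notation Y alpha n := (survival R (pre n alpha)).

Lemma survival_pre_itv alpha n : (2 <= n)%N -> 0 < Y alpha n <= 1.
Proof. by move=> n2; apply: survival_itv; exact: admissible_pre. Qed.

Lemma survival_pre_ninc alpha m n : (2 <= m <= n)%N -> Y alpha n <= Y alpha m.
Proof.
case/andP=> m2 /subnKC <-; elim: (n - m)%N => [|d ih]; first by rewrite addn0.
apply: le_trans ih; rewrite addnS preS; last by rewrite ltn_addr.
have /andP[y0 _] := @survival_pre_itv alpha (m + d) (ltn_addr d m2).
case: ifP => // _; by rewrite survival_rcons ler_piMr ?(ltW y0) // gerBl invr_ge0.
Qed.

(** A shift by [k] is a chain of [k] unit shifts, each of which telescopes to at most 1. *)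
Lemma sum_survival_shift_le alpha k n :
  \sum_(2 <= m < n) (Y alpha m - Y alpha (m + k)) <= k%:R.
Proof.
elim: k => [|k ih].
  by rewrite big1 // => m _; rewrite addn0 subrr.
have [n2|n2] := leqP n 2; first by rewrite big_geq.
rewrite (eq_bigr (fun m => (Y alpha m - Y alpha (m + k)) +
   (Y alpha (m + k) - Y alpha (m.+1 + k)))); last first.
  by move=> m _; rewrite addSnnS; ring.
rewrite big_split /= -[k.+1]addn1 natrD; apply: lerD ih _.
have tele : \sum_(2 <= m < n) (Y alpha (m + k) - Y alpha (m.+1 + k)) =
    Y alpha (2 + k) - Y alpha (n + k).
  transitivity (\sum_(2 <= m < n) ((- Y alpha (m.+1 + k)) - (- Y alpha (m + k)))).
    by apply: eq_bigr => m _; rewrite opprK addrC.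
  rewrite (telescope_sumr (fun m => - Y alpha (m + k)) (ltnW n2)).
  by rewrite opprK addrC.
rewrite tele.
have /andP[_ a1] := @survival_pre_itv alpha (2 + k) isT.
have /andP[b0 _] := @survival_pre_itv alpha (n + k) (ltn_addr k (ltnW n2)).
by lra.
Qed.

Definition occurs alpha r m : bool := all (fun k => `[< terms alpha (m + k) >]) r.

Lemma occurs_rcons alpha r k m :
  (occurs alpha (rcons r k) m)%:R = (occurs alpha r m)%:R * `[< terms alpha (m + k) >]%:R :> R.
Proof. by rewrite -natrM mulnb /occurs all_rcons andbC. Qed.

(* [Y_m^c] times the indicator of [m + r] inside [alpha], at [n = m + k],
   as a function of [alpha_n]. *)
Definition predictor c r k n s : R :=
  if (n < k.+2)%N then 0 else
  survival R [seq a <- s | (a < n - k)%N] ^+ c *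
    (all (fun j => (n - k + j)%N \in s) r)%:R.

Lemma admissible_filter s m n : (2 <= m)%N -> admissible s n ->
  admissible [seq a <- s | (a < m)%N] m.
Proof.
move=> m2 /and3P[_ ss /allP sn]; apply/and3P; split => //.
  exact: (sorted_filter ltn_trans).
by apply/allP => a; rewrite mem_filter => /andP[-> /sn /andP[->]].
Qed.

Lemma predictor_le1 c r k n s : admissible s n -> `|predictor c r k n s| <= 1.
Proof.
move=> sn; rewrite /predictor; case: ltnP => nk; first by rewrite normr0.
have /andP[y0 y1] : 0 < survival R [seq a <- s | (a < n - k)%N] <= 1.
  by apply/survival_itv/(admissible_filter _ sn); lia.
rewrite normrM normrX (ger0_norm (ltW y0)) normr_nat.
have yc : survival R [seq a <- s | (a < n - k)%N] ^+ c <= 1.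
  by rewrite exprn_ile1 // ltW.
by rewrite mulr_natr; case: all; rewrite ?mulr1n ?mulr0n ?ler01.
Qed.

(** Offsets smaller than [k] keep every [m + j] below [m + k], so the prefix already decides the
    pattern: this is predictability. *)
Lemma predictor_pre c r k m alpha : (2 <= m)%N -> all (ltn^~ k) r ->
  predictor c r k (m + k) (pre (m + k) alpha) =
  Y alpha m ^+ c * (occurs alpha r m)%:R.
Proof.
move=> m2 /allP rk; rewrite /predictor ltnNge addnC -addn2 leq_add2l m2 /=.
rewrite addKn filter_lt_pre ?leq_addl //; congr (_ * _%:R).
congr nat_of_bool; apply: eq_in_all => j /rk jk; rewrite mem_pre.
by have -> : (2 <= m + j < k + m)%N by rewrite /= in jk *; lia.
Qed.

(** Reindexing by [m + k]: the martingale runs over the positions 2 to [n + k - 1], and [predictor]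
    vanishes below [k + 2], so that [m] starts at 2. *)
Lemma mart_predictor c r k n alpha : all (ltn^~ k) r -> (2 <= n)%N ->
  mart (predictor c r k) (n + k - 2) (pre (n + k - 2).+2 alpha) =
  \sum_(2 <= m < n) Y alpha m ^+ c * (occurs alpha r m)%:R *
    (`[< terms alpha (m + k) >]%:R - Y alpha (m + k)).
Proof.
move=> rk; elim: n => // -[_ //|[_ _|n ih _]].
  rewrite addnC addnK [RHS]big_geq // mart_pre big_nat big1 // => j /andP[_ jk].
  by rewrite /predictor !ltnS jk mul0r.
rewrite big_nat_recr // -ih //= (_ : n.+3 + k - 2 = (n.+2 + k - 2).+1)%N; last by lia.
rewrite !mart_pre big_nat_recr //=; congr (_ + _).
rewrite (_ : (n.+2 + k - 2).+2 = n.+2 + k)%N; last by lia.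
by rewrite predictor_pre.
Qed.

Lemma bounded_negligible (B : nat -> R) (K : R) l : (forall n, `|B n| <= K) ->
  B n * (ln n%:R ^+ l / n%:R) @[n --> \oo] --> (0 : R).
Proof.
move=> BK; apply: norm_cvg0.
apply: (@squeeze_cvgr _ _ _ _ (cst 0) (fun n => K * `|ln n%:R ^+ l / n%:R|)).
- by apply: nearW => n; rewrite normr_ge0 normrM ler_wpM2r.
- exact: cvg_cst.
- rewrite -[X in _ --> X](mulr0 K); apply: cvgMl_tmp.
  rewrite -[X in _ --> X](normr0 R); apply: cvg_norm; exact: cvg_lnn_expr_div.
Qed.

(** With [I] the indicator for [r] and [J] that of [m + k], the step from [r] to [rcons r k] rests
    on [I J - Y_m^(s+1) = I (J - Y_(m+k)) - I (Y_m - Y_(m+k)) + Y_m (I - Y_m^s)], where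
    [s = size r]: a martingale, a bounded sum, and the induction hypothesis. *)
Lemma ae_constellation_negligible (mu : probability sieve_space R) c r l :
  hawkins_measure mu -> sorted ltn r ->
  {ae mu, forall alpha : sieve_space,
    (\sum_(2 <= m < n) Y alpha m ^+ c *
       ((occurs alpha r m)%:R - Y alpha m ^+ size r)) * (ln n%:R ^+ l / n%:R)
    @[n --> \oo] --> (0 : R)}.
Proof.
move=> hmu; elim/last_ind: r c => [|r k ih] c.
  move=> _; apply: aeW => alpha.
  under eq_fun => n.
    rewrite big1 ?mul0r; last by move=> m _; rewrite /= expr0 subrr mulr0.
    over.
  exact: cvg_cst.
(* Sortedness makes the last offset [k] larger than all those in [r], as predictability requires. *)
rewrite sorted_pairwise; last exact: ltn_trans.
rewrite pairwise_rcons => /andP[rk]; rewrite -sorted_pairwise; last exact: ltn_trans.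
(* The exponent rises by one because the replaced indicator leaves a factor [Y_m]. *)
move=> /(ih c.+1).
apply: filterS2 (ae_mart hmu (@predictor_le1 c r k)) => alpha hm hr.
pose M i := mart (predictor c r k) i (pre i.+2 alpha).
have M1 i : `|M i.+1 - M i| <= 1.
  rewrite /M !mart_pre big_nat_recr //= addrAC subrr add0r normrM.
  rewrite -[leRHS](mulr1 1); apply: ler_pM => //.
    by apply: predictor_le1; exact: admissible_pre.
  have /andP[] := @survival_pre_itv alpha i.+2 isT.
  by case: asbool => y0 y1; rewrite ler_norml /=; lra.
have cM := @lipschitz_negligible R M k 2 l M1 hm.
(* The cost of evaluating [Y] at [m] instead of [m + k]; weights between 0 and 1 leave the
   telescoping bound intact. *)
pose B n := \sum_(2 <= m < n) Y alpha m ^+ c * (occurs alpha r m)%:R *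
  (Y alpha m - Y alpha (m + k)).
have BK n : `|B n| <= k%:R.
  apply: le_trans (sum_survival_shift_le alpha k n).
  have t m : (2 <= m)%N -> 0 <= Y alpha m ^+ c * (occurs alpha r m)%:R *
      (Y alpha m - Y alpha (m + k)) <= Y alpha m - Y alpha (m + k).
    move=> m2; have /andP[y0 y1] := survival_pre_itv alpha m2.
    have : Y alpha (m + k) <= Y alpha m by apply: survival_pre_ninc; rewrite m2 leq_addr.
    rewrite -subr_ge0; set d := _ - _ => d0.
    have y : 0 <= Y alpha m ^+ c <= 1 by rewrite exprn_ge0 ?exprn_ile1 // ltW.
    case: occurs; rewrite ?mulr1 ?mulr0 ?mul0r ?lexx //; apply/andP; split; nra.
  rewrite ger0_norm; first by apply: ler_sum_nat => m /andP[/t/andP[]].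
  by rewrite /B big_nat_cond sumr_ge0 // => m /andP[/andP[/t/andP[]]].
have cB := @bounded_negligible B k%:R l BK.
rewrite -[X in _ --> X](_ : 0 - 0 + 0 = 0); last by ring.
apply: cvg_trans (cvgD (cvgB cM cB) hr); apply: near_eq_cvg; near=> n.
have n2 : (2 <= n)%N by near: n; exact: nbhs_infty_ge.
rewrite /= !fctE /M mart_predictor //  -mulrBl -mulrDl; congr (_ * _).
rewrite /B -sumrB -big_split /=; apply: eq_bigr => m _.
rewrite occurs_rcons size_rcons !exprS; ring.
Unshelve. all: by end_near. Qed.

(** * From sums over integers to the counting function of a real variable *)

Lemma constellation_countE ks alpha (x : R) : 0 <= x ->
  (constellation_count ks alpha x)%:R =
  \sum_(2 <= m < (Num.truncn x).+1) (occurs alpha (0%N :: ks) m)%:R :> R.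
Proof.
move=> x0; rewrite /constellation_count.
set N := (Num.truncn x).+1.
set S := [set m | _].
have -> : S = [set` [seq m <- index_iota 2 N | occurs alpha (0%N :: ks) m]].
  apply/seteqP; split => m /=.
    move=> [mx /= sub]; rewrite mem_filter mem_index_iota.
    have mr k : k \in 0%N :: ks -> terms alpha (m + k) by move=> kk; apply: sub; exists k.
    apply/andP; split; first by apply/(@allP _ _ (0%N :: ks)) => k /mr ?; apply/asboolP.
    (* Offset 0 puts [m] itself in [alpha], hence [m > 1] and the sum may start at 2. *)
    have : (1 < m + 0)%N := terms_gt1 (mr 0%N (mem_head _ _)); rewrite addn0 => ->.
    by rewrite /= /N ltnS truncn_ge_nat.
  rewrite mem_filter mem_index_iota => /andP[/(@allP _ _ (0%N :: ks)) ho /andP[m2 mN]]; split.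
    by rewrite -truncn_ge_nat // -ltnS.
  by move=> _ [k kk <-]; have /asboolP := ho k kk.
set s := [seq m <- _ | _].
have -> : [set` s] = [set` [fset m in s]%fset].
  by apply/seteqP; split => m /=; rewrite !inE.
rewrite set_fsetK card_fseq undup_id ?filter_uniq ?iota_uniq //.
rewrite size_filter -sum1_count natr_sum big_mkcond; apply: eq_bigr => m _.
by case: occurs.
Qed.

End constellations.

(** The integer [N = floor x + 1] satisfies [N/x -> 1] and [ln x / ln N -> 1], so the two
    normalisations agree in the limit. *)
Lemma cvg_truncnS (R : realType) (G : nat -> R) l :
  G n * (ln n%:R ^+ l / n%:R) @[n --> \oo] --> (1 : R) ->
  G (Num.truncn x).+1 / (x / ln x ^+ l) @[x --> +oo] --> (1 : R).
Proof.
pose N (x : R) := (Num.truncn x).+1.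
have Noo : N x @[x --> +oo] --> \oo.
  apply/cvgnyPge => A; near=> x; rewrite /N ltnW // ltnS truncn_ge_nat.
    by near: x; exact: nbhs_pinfty_ge.
  by near: x; exact: nbhs_pinfty_ge.
have NP : \forall x \near +oo, 1 < x /\ x <= (N x)%:R <= x + 1.
  near=> x; have x1 : 1 < x by near: x; exact: nbhs_pinfty_gt.
  split => //; apply/andP; split; first exact/ltW/truncnS_gt.
  by rewrite /N -[_.+1]addn1 natrD lerD2r truncn_le; lra.
have lim1 : (N x)%:R / x @[x --> +oo] --> (1 : R).
  apply: (@squeeze_cvgr _ _ _ _ (cst 1) (fun x => 1 + x^-1)).
  - near=> x; have [x1 /andP[xN Nx]] : 1 < x /\ x <= (N x)%:R <= x + 1 by near: x.
    have x0 : 0 < x by lra.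
    rewrite ler_pdivlMr // mul1r xN ler_pdivrMr // mulrDl mul1r mulVf //; lra.
  - exact: cvg_cst.
  - rewrite -[X in _ --> X](addr0 1); apply: cvgD; first exact: cvg_cst.
    exact: cvg_inv_pinfty.
have lim2 : ln x / ln (N x)%:R @[x --> +oo] --> (1 : R).
  apply: (@squeeze_cvgr _ _ _ _ (fun x => 1 - (ln x)^-1) (cst 1)).
  - near=> x; have [x1 /andP[xN Nx]] : 1 < x /\ x <= (N x)%:R <= x + 1 by near: x.
    have x0 : 0 < x by lra.
    have l0 := ln_gt0 x1.
    have lN : ln x <= ln (N x)%:R by rewrite ler_ln ?posrE //; lra.
    (* Then [ln x / ln N >= ln x / (ln x + 1) >= 1 - 1/ln x]. *)
    have Nl : ln (N x)%:R <= ln x + 1.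
      apply: le_trans (_ : ln (x * (1 + x^-1)) <= _).
        have i0 : 0 < x^-1 by rewrite invr_gt0.
        rewrite ler_ln ?posrE ?mulr_gt0 ?addr_gt0 //.
        by rewrite mulrDr mulr1 divff // gt_eqF.
      have i0 : 0 < x^-1 by rewrite invr_gt0.
      have i1 : x^-1 < 1 by rewrite invf_lt1.
      rewrite lnM ?posrE ?addr_gt0 // lerD2l.
      by apply: le_trans (le_ln1Dx _) (ltW i1); apply: lt_trans i0; rewrite oppr_lt0.
    have lN0 : 0 < ln (N x)%:R := lt_le_trans l0 lN.
    rewrite ler_pdivrMr // mul1r lN andbT ler_pdivlMr //.
    have -> : 1 - (ln x)^-1 = (ln x - 1) / ln x by field; lra.
    by rewrite mulrAC ler_pdivrMr //; nra.
  - rewrite -[X in _ --> X](subr0 1); apply: cvgB; first exact: cvg_cst.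
    by apply: cvg_inv_pinfty; exact: cvgr_ln_pinfty.
  - exact: cvg_cst.
move=> /(cvg_comp _ _ Noo) limG.
rewrite -[X in _ --> X](_ : 1 * (1 * 1 ^+ l) = 1); last by rewrite expr1n !mulr1.
apply: cvg_trans (cvgM limG (cvgM lim1 (@cvg_expr_n _ _ _ _ _ l _ lim2))).
apply: near_eq_cvg; near=> x.
have [x1 /andP[xN Nx]] : 1 < x /\ x <= (N x)%:R <= x + 1 by near: x.
have x0 : x != 0 by lra.
have l0 : ln x != 0 by rewrite gt_eqF // ln_gt0.
have N0 : (N x)%:R != 0 :> R by lra.
have lN0 : ln (N x)%:R != 0 :> R by rewrite gt_eqF // ln_gt0 //; lra.
rewrite /= -/(N x) exprMn exprVn; field.
by rewrite x0 N0 !expf_neq0.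
Unshelve. all: by end_near. Qed.

Theorem theorem3 (R : realType) (mu : probability sieve_space R)
    (mu_hawkins : hawkins_measure mu)
    (l : nat) (l_ge2 : (2 <= l)%N)
    (ks : (l.-1).-tuple nat) (ks_incr : path ltn 0%N ks) :
  {ae mu, forall alpha : sieve_space,
    (constellation_count ks alpha x)%:R / (x / ln x ^+ l) @[x --> +oo]
      --> (1 : R)}.
Proof.
(* [ks_incr] says that [0 :: ks] is sorted; the exponent 0 leaves the pattern unweighted. *)
apply: filterS2 (ae_inv_survival mu_hawkins)
  (@ae_constellation_negligible R mu 0 (0%N :: ks) l mu_hawkins ks_incr).
move=> alpha hY hks.
have Yitv := @survival_pre_itv R alpha.
have Yln : survival R (pre n alpha) * ln n%:R @[n --> \oo] --> (1 : R).
  apply: survival_asymp hY => [n /Yitv/andP[]//|]; exact: survival_pre_ninc.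
have hl : (\sum_(2 <= m < n) survival R (pre m alpha) ^+ l) * (ln n%:R ^+ l / n%:R)
    @[n --> \oo] --> (1 : R).
  apply: power_sum_asymp Yln => [n /Yitv/andP[]//|n /Yitv/andP[]//|].
  exact: survival_pre_ninc.
have size_ks : (size ks).+1 = l by rewrite size_tuple prednK // ltnW.
have cvgG : (\sum_(2 <= m < n) (occurs alpha (0%N :: ks) m)%:R) * (ln n%:R ^+ l / n%:R)
    @[n --> \oo] --> (1 : R).
  (* The indicator is [Y_m^l] plus the negligible difference. *)
  rewrite -[X in _ --> X](add0r 1).
  apply: cvg_trans (cvgD hks hl); apply: near_eq_cvg.
  apply: nearW => n; rewrite !fctE /= -mulrDl -big_split /=; congr (_ * _).
  by apply: eq_bigr => m _; rewrite size_ks expr0 mul1r subrK.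
apply: cvg_trans (cvg_truncnS cvgG); apply: near_eq_cvg; near=> x.
by rewrite constellation_countE.
Unshelve. all: by end_near. Qed.
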